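(* Let $N\ge2$ be an integer, $\bar\tau>0$, $\omega>0$, $\varepsilon\in(-1,0)$. If $\rho:\mathbb{R}^N\to\mathbb{R}_{\ge0}$ is continuous, and positive on $\mathbb{R}^N\setminus\mathcal{A}$, then $\mathcal{A}$ is semiglobally practically robustly $\mathcal{KL}$ asymptotically stable for $\mathcal{H}_N$ with basin of attraction $\mathcal{B}_{\mathcal{A}}=P_N\setminus\mathcal{X}$; i.e., there exists a class-$\mathcal{KL}$ function $\beta$ such that for every compact set $K\subset\mathcal{B}_{\mathcal{A}}$ and every $\alpha>0$, there exists $\delta\in(0,1)$ such that every maximal solution $\tau$ to $\mathcal{H}_{N,\delta\rho}$ from $K$ (i.e. with $\tau(0,0)\in K$) satisfies $$|\tau(t,j)|_{\mathcal{A}}\le\beta(|\tau(0,0)|_{\mathcal{A}},t+j)+\alpha\qquad\text{for all }(t,j)\in\operatorname{dom}\tau .$$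
   Context: **The hybrid system $\mathcal{H}_N$.** Let $N\ge 2$ be an integer, $\bar\tau>0$, $\omega>0$, $\varepsilon\in(-1,0)$, $I=\{1,\dots,N\}$, $P_N=[0,\bar\tau]^N$, and let $\mathbf 1\in\mathbb{R}^N$ be the vector of ones. $\mathcal{H}_N=(C,f,D,G)$ has state $\tau=(\tau_1,\dots,\tau_N)$, with $\dot\tau=f(\tau)$ for $\tau\in C$ and $\tau^+\in G(\tau)$ for $\tau\in D$, where $C=P_N$, $f(\tau)=\omega\mathbf 1$, $D=\{\tau\in P_N:\exists i\in I,\ \tau_i=\bar\tau\}$, and for $\tau\in D$, $G(\tau)=g_1(\tau)\times\cdots\times g_N(\tau)$ (vectors whose $i$-th component lies in $g_i(\tau)$) with - $g_i(\tau)=\{0\}$ if $\tau_i=\bar\tau$ and $\tau_r<\bar\tau$ for all $r\in I\setminus\{i\}$; - $g_i(\tau)=\{0,(1+\varepsilon)\tau_i\}$ if $\tau_i=\bar\tau$ and there is $r\in I\setminus\{i\}$ with $\tau_r=\bar\tau$; - $g_i(\tau)=\{(1+\varepsilon)\tau_i\}$ if $\tau_i<\bar\tau$ and there is $r\in I\setminus\{i\}$ with $\tau_r=\bar\tau$. **Perturbed system.** Let $\mathbb{B}$ be the closed unit ball of $\mathbb{R}^N$. For $\rho:\mathbb{R}^N\to\mathbb{R}_{\ge0}$, the $\rho$-perturbation $\mathcal{H}_{N,\rho}$ is the hybrid system $\dot\tau\in F_\rho(\tau)$ for $\tau\in C_\rho$, $\tau^+\in G_\rho(\tau)$ for $\tau\in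 D_\rho$, with $C_\rho=\{\tau\in\mathbb{R}^N:(\tau+\rho(\tau)\mathbb{B})\cap C\ne\emptyset\}$, $F_\rho(\tau)=\omega\mathbf 1+\rho(\tau)\mathbb{B}$ for $\tau\in C_\rho$, $D_\rho=\{\tau\in\mathbb{R}^N:(\tau+\rho(\tau)\mathbb{B})\cap D\neq\emptyset\}$, $G_\rho(\tau)=\{v\in\mathbb{R}^N:v\in g+\rho(g)\mathbb{B},\ g\in G((\tau+\rho(\tau)\mathbb{B})\cap D)\}$. $\mathcal{H}_{N,\delta\rho}$ is this system with $\rho$ replaced by $\delta\rho$. **Solutions.** A compact hybrid time domain is a set $\bigcup_{j=0}^{J-1}([t_j,t_{j+1}]\times\{j\})$ with $0=t_0\le t_1\le\dots\le t_J$; a set $S\subset\mathbb{R}_{\ge0}\times\mathbb{N}$ is a hybrid time domain if $S\cap([0,T]\times\{0,\dots,J\})$ is a compact hybrid time domain for every $(T,J)\in S$. A hybrid arc is a function $x$ on a hybrid time domain $\operatorname{dom}x$ such that $t\mapsto x(t,j)$ is locally absolutely continuous for each $j$. It is a solution of a hybrid system with flow set $C$, flow map $F$, jump set $D$, jump map $G$ if $x(0,0)\in C\cup D$; for all $j$ and almost all $t$ with $(t,j)\in\operatorname{dom}x$, $x(t,j)\in C$ and $\dot x(t,j)\in F(x(t,j))$; and whenever $(t,j),(t,j+1)\in\operatorname{dom}x$, $x(t,j)\in D$ and $x(t,j+1)\in G(x(t,j))$. A solution is maximal if it is not a proper truncation of another solution. **The set $\mathcal{X}$.** $\mathcal{X}=\mathcal{S}\cup\mathcal{G}$,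 where $\mathcal{S}=\{\tau\in P_N:\exists i,r\in I,\ i\ne r,\ \tau_i=\tau_r\}$ and $\mathcal{G}=\{\tau\in D\setminus\mathcal{S}:\exists i,r\in I,\ i\neq r,\ \tau_i=0,\ \tau_r=\bar\tau\}$. **The desynchronization set $\mathcal{A}$.** Let $\Gamma$ be the $N\times N$ matrix whose first row is $(1,0,\dots,0)$; whose second row has entry $2+\varepsilon$ in column 2, $-(1+\varepsilon)$ in column 3 (if $N\ge3$), and zeros elsewhere; and whose $k$-th row, $3\le k\le N$, has entry $1+\varepsilon$ in column 2, $1$ in column $k$, $-(1+\varepsilon)$ in column $k+1$ (if $k<N$), and zeros elsewhere. Let $\tau_s\in\mathbb{R}^N$ be the solution of $\Gamma\tau_s=\bar\tau\mathbf 1$ (its entries are in decreasing order). Let $\tilde\tau^1,\dots,\tilde\tau^{N!}$ be the $N!$ points obtained by permuting the components of $\tau_s$ in all possible ways. Set $\ell_k=\{\tau\in P_N:\tau=\tilde\tau^k+s\mathbf 1,\ s\in\mathbb{R}\}$ and $\mathcal{A}=\bigcup_{k=1}^{N!}\ell_k$. $|x|_{\mathcal{A}}=\min_{z\in\mathcal{A}}|x-z|$ (Euclidean norm). A function $\beta:\mathbb{R}_{\ge0}\times\mathbb{R}_{\ge0}\to\mathbb{R}_{\ge0}$ is of class $\mathcal{KL}$ if it is nondecreasing in its first argument, nonincreasing in its second, $\lim_{r\to0^+}\beta(r,s)=0$ for each $s$, and $\lim_{s\to\infty}\beta(r,s)=0$ for each $r$. *)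

(* Defs.v *)
From HB Require Import structures.
From mathcomp Require Import all_boot all_order all_algebra perm ring.
From mathcomp Require Import all_classical all_reals all_analysis.

Set Implicit Arguments.
Unset Strict Implicit.
Unset Printing Implicit Defensive.

Import Order.TTheory GRing.Theory Num.Theory.
Import numFieldNormedType.Exports.

Local Open Scope classical_set_scope.
Local Open Scope ring_scope.

(* The library norm of 'rV[R]_N is the sup norm. Its topology is the Euclidean
   one, but radii and distances have to be measured with [enorm]. *)
Definition enorm (R : realType) (N : nat) (x : 'rV[R]_N) : R :=
  Num.sqrt (\sum_(i < N) x ord0 i ^+ 2).

Definition unit_ball (R : realType) (N : nat) : set 'rV[R]_N :=
  [set b | enorm b <= 1].

Definition ball_around (R : realType) (N : nat) (x : 'rV[R]_N) (r : R) :
    set 'rV[R]_N :=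
  [set x + r *: b | b in @unit_ball R N].

(* An infimum, which is the minimum when [A] is nonempty and closed. *)
Definition dist_to (R : realType) (N : nat) (A : set 'rV[R]_N) (x : 'rV[R]_N) : R :=
  inf [set enorm (x - z) | z in A].

(* The library's functions are total, so the sign and monotonicity requirements
   are restricted to nonnegative arguments. *)
Definition class_KL (R : realType) (beta : R -> R -> R) : Prop :=
  [/\ forall r s, 0 <= r -> 0 <= s -> 0 <= beta r s,
      forall r r' s, 0 <= r -> r <= r' -> 0 <= s -> beta r s <= beta r' s,
      forall r s s', 0 <= r -> 0 <= s -> s <= s' -> beta r s' <= beta r s,
      forall s, 0 <= s -> beta r s @[r --> 0^'+] --> (0 : R) &
      forall r, 0 <= r -> beta r s @[s --> +oo] --> (0 : R)].

Record hybrid_system (R : realType) (N : nat) := HybridSystem {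
  flow_set : set 'rV[R]_N ;
  flow_map : 'rV[R]_N -> set 'rV[R]_N ;
  jump_set : set 'rV[R]_N ;
  jump_map : 'rV[R]_N -> set 'rV[R]_N
}.

Definition compact_hybrid_time_domain (R : realType) (S : set (R * nat)) : Prop :=
  exists (J : nat) (t : nat -> R),
    [/\ t 0%N = 0,
        forall j, (j < J)%N -> t j <= t j.+1 &
        S = [set p | (p.2 < J)%N /\ t p.2 <= p.1 <= t p.2.+1]].

Definition hybrid_time_domain (R : realType) (S : set (R * nat)) : Prop :=
  (forall p, S p -> 0 <= p.1) /\
  forall (T : R) (J : nat), S (T, J) ->
    compact_hybrid_time_domain
      (S `&` [set p | 0 <= p.1 <= T /\ (p.2 <= J)%N]).

Definition abs_continuous (R : realType) (N : nat) (a b : R) (f : R -> 'rV[R]_N) :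
    Prop :=
  forall e : R, 0 < e -> exists2 d : R, 0 < d &
    forall (n : nat) (u v : 'I_n -> R),
      (forall i, [/\ a <= u i, u i <= v i & v i <= b]) ->
      (forall i k, i != k -> v i <= u k \/ v k <= u i) ->
      \sum_(i < n) (v i - u i) < d ->
      \sum_(i < n) enorm (f (v i) - f (u i)) < e.

Definition locally_abs_continuous (R : realType) (N : nat) (I : set R)
    (f : R -> 'rV[R]_N) : Prop :=
  forall a b : R, `[a, b]%classic `<=` I -> abs_continuous a b f.

(* The values outside of the domain are irrelevant. *)
Record hybrid_trajectory (R : realType) (N : nat) := HybridTrajectory {
  arc_dom : set (R * nat) ;
  arc_val :> R -> nat -> 'rV[R]_N
}.

Definition hybrid_arc (R : realType) (N : nat) (x : hybrid_trajectory R N) : Prop :=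
  hybrid_time_domain (arc_dom x) /\
  forall j, locally_abs_continuous [set t | arc_dom x (t, j)] (x^~ j).

(* The two-sided derivative sees the values of [x] outside of its domain only at
   the at most two endpoints of each interval, which are negligible; when the
   interval is a single point, the flow condition is void. *)
Definition is_solution (R : realType) (N : nat) (H : hybrid_system R N)
    (x : hybrid_trajectory R N) : Prop :=
  [/\ hybrid_arc x,
      arc_dom x (0, 0%N),
      (flow_set H `|` jump_set H) (x 0 0%N),
      forall j, {ae (@lebesgue_measure R), forall t : R, arc_dom x (t, j) ->
        [/\ flow_set H (x t j), derivable (x^~ j) t 1 &
            flow_map H (x t j) (derive1 (x^~ j) t)]} &
      forall t j, arc_dom x (t, j) -> arc_dom x (t, j.+1) ->
        jump_set H (x t j) /\ jump_map H (x t j) (x t j.+1)].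

Definition proper_truncation (R : realType) (N : nat) (x y : hybrid_trajectory R N) : Prop :=
  arc_dom x `<` arc_dom y /\ forall t j, arc_dom x (t, j) -> x t j = y t j.

Definition maximal_solution (R : realType) (N : nat) (H : hybrid_system R N)
    (x : hybrid_trajectory R N) : Prop :=
  is_solution H x /\ ~ exists2 y, is_solution H y & proper_truncation x y.

(* The flow map is not averaged over a neighbourhood: the one of the system
   below is constant. *)
Definition perturbation (R : realType) (N : nat) (H : hybrid_system R N)
    (rho : 'rV[R]_N -> R) : hybrid_system R N :=
  {| flow_set := [set x | ball_around x (rho x) `&` flow_set H !=set0] ;
     flow_map := fun x => [set w | exists2 f, flow_map H x f &
                                     ball_around f (rho x) w] ;
     jump_set := [set x | ball_around x (rho x) `&` jump_set H !=set0] ;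
     jump_map := fun x =>
       [set v | exists2 g,
          (\bigcup_(y in ball_around x (rho x) `&` jump_set H) jump_map H y) g &
          ball_around g (rho g) v] |}.

Definition cube (R : realType) (N : nat) (tbar : R) : set 'rV[R]_N :=
  [set x | forall i, 0 <= x ord0 i <= tbar].

Definition threshold_set (R : realType) (N : nat) (tbar : R) : set 'rV[R]_N :=
  [set x | cube tbar x /\ exists i, x ord0 i = tbar].

Definition component_jump (R : realType) (N : nat) (tbar eps : R)
    (x : 'rV[R]_N) (i : 'I_N) : set R :=
  [set v |
    [\/ [/\ x ord0 i = tbar, forall r, r != i -> x ord0 r < tbar & v = 0],
        [/\ x ord0 i = tbar, exists2 r, r != i & x ord0 r = tbar &
            v = 0 \/ v = (1 + eps) * x ord0 i] |
        [/\ x ord0 i < tbar, exists2 r, r != i & x ord0 r = tbar &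
            v = (1 + eps) * x ord0 i]]].

Definition impulsive_oscillators (R : realType) (N : nat) (tbar omega eps : R) :
    hybrid_system R N :=
  {| flow_set := cube tbar ;
     flow_map := fun=> [set const_mx omega] ;
     jump_set := threshold_set tbar ;
     jump_map := fun x =>
       [set v | forall i, component_jump tbar eps x i (v ord0 i)] |}.

Definition sync_set (R : realType) (N : nat) (tbar : R) : set 'rV[R]_N :=
  [set x | cube tbar x /\ exists i r, i != r /\ x ord0 i = x ord0 r].

Definition zero_threshold_set (R : realType) (N : nat) (tbar : R) :
    set 'rV[R]_N :=
  [set x | (threshold_set tbar `\` sync_set tbar) x /\
     exists i r, [/\ i != r, x ord0 i = 0 & x ord0 r = tbar]].

Definition bad_set (R : realType) (N : nat) (tbar : R) : set 'rV[R]_N :=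
  sync_set tbar `|` zero_threshold_set tbar.

(* Rows and columns are numbered from 0. *)
Definition Gamma (R : realType) (N : nat) (eps : R) : 'M[R]_N :=
  \matrix_(i < N, j < N)
    (if i == 0%N :> nat then (if j == 0%N :> nat then 1 else 0)
     else if i == 1%N :> nat then
       (if j == 1%N :> nat then 2 + eps
        else if j == 2%N :> nat then - (1 + eps) else 0)
     else
       (if j == 1%N :> nat then 1 + eps
        else if j == i :> nat then 1
        else if j == i.+1 :> nat then - (1 + eps) else 0)).

Definition tau_s (R : realType) (N : nat) (tbar eps : R) : 'rV[R]_N :=
  (invmx (Gamma N eps) *m const_mx tbar)^T.

Lemma Gamma_inj (R : realType) (N : nat) (eps : R) (v : 'cV[R]_N) :
  (2 <= N)%N -> -1 < eps -> Gamma N eps *m v = 0 -> v = 0.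
Proof.
case: N v => [|[|n]] // v _ eps1 Gv0.
have l0 : 0 < 1 + eps by rewrite -ltrBlDl sub0r.
set l := 1 + eps in l0.
pose w k : R := if insub k is Some i then v (i : 'I_n.+2) ord0 else 0.
have wE (i : 'I_n.+2) : w i = v i ord0 by rewrite /w valK.
have w_out k : (n.+2 <= k)%N -> w k = 0.
  by move=> kn; rewrite /w insubN // -leqNgt.
have sumE (k : nat) (c : R) :
    \sum_(j < n.+2) (if j == k :> nat then c else 0) * v j ord0 = c * w k.
  have [kn|nk] := ltnP k n.+2.
    rewrite (bigD1 (Ordinal kn)) //= eqxx big1 ?addr0 -?wE // => j jk.
    by rewrite ifN ?mul0r.
  rewrite w_out // mulr0 big1 // => j _.
  by rewrite ifN ?mul0r // neq_ltn (leq_trans (ltn_ord j)).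
have w0 : w 0%N = 0.
  have /matrixP/(_ ord0 ord0) := Gv0.
  rewrite !mxE => <-; rewrite -[LHS]mul1r -sumE.
  by apply: eq_bigr => j _; rewrite mxE.
have rec k : (0 < k < n.+2)%N -> w k = l * w k.+1 - l * w 1%N.
  move=> /andP[k0 kn].
  have /matrixP/(_ (Ordinal kn) ord0) := Gv0.
  rewrite !mxE => E.
  have : l * w 1%N + w k - l * w k.+1 = 0.
    rewrite -[w k]mul1r -mulNr -!sumE -!big_split /= -[RHS]E.
    apply: eq_bigr => j _; rewrite mxE /= -!mulrDl; congr (_ * _).
    case: k k0 {kn E} => // -[|k] _ /=.
      case: (nat_of_ord j) => [|[|[|m]]] //=; rewrite ?addr0 ?add0r //.
      by rewrite /l addrC addrA.
    have [->|j1] := eqVneq (nat_of_ord j) 1%N; first by rewrite !addr0.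
    have [->|jk] := eqVneq (nat_of_ord j) k.+2.
      by rewrite ltn_eqF // add0r addr0.
    by rewrite !add0r.
  by move=> /eqP; rewrite subr_eq0 addrC eq_sym -subr_eq => /eqP <-.
have geom m : (m <= n.+1)%N ->
    w (n.+2 - m)%N = - w 1%N * \sum_(1 <= k < m.+1) l ^+ k.
  elim: m => [|m IH] mn; first by rewrite subn0 w_out // big_geq // mulr0.
  rewrite rec; last by rewrite subn_gt0 ltnS mn /= ltn_subrL.
  rewrite -subSn ?subSS; last exact: leq_trans mn _.
  rewrite IH; last exact: ltnW.
  have -> : \sum_(1 <= k < m.+2) l ^+ k = l + l * \sum_(1 <= k < m.+1) l ^+ k.
    rewrite [LHS]big_nat_recl // expr1 big_distrr /=; congr (_ + _).
    by apply: eq_bigr => k _; rewrite exprS.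
  by ring.
have w1 : w 1%N = 0.
  have := geom n.+1 (leqnn _); rewrite subSn // subnn => /eqP.
  rewrite mulNr -addr_eq0 -{1}[w 1%N]mulr1 -mulrDr mulf_eq0 => /orP[/eqP //|].
  rewrite gt_eqF // ltr_pwDl // sumr_ge0 // => k _.
  by rewrite exprn_ge0 // ltW.
apply/colP => i; rewrite mxE -wE.
case: i => -[|k] //= kn.
have := geom (n.+2 - k.+1)%N; rewrite subKn ?(ltnW kn) // => ->.
  by rewrite w1 oppr0 mul0r.
by rewrite subSS leq_subr.
Qed.

(* So [tau_s] is indeed the unique solution of the defining linear system. *)
Lemma tau_sP (R : realType) (N : nat) (tbar eps : R) (v : 'cV[R]_N) :
  (2 <= N)%N -> -1 < eps ->
  Gamma N eps *m v = const_mx tbar <-> v = (tau_s N tbar eps)^T.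
Proof.
move=> N2 eps1.
have unitG : Gamma N eps \in unitmx.
  rewrite unitmxE unitfE -det_tr; apply/negP => /det0P[u u0 uG].
  move/negP: u0; apply; rewrite -trmx_eq0; apply/eqP.
  by apply: (Gamma_inj N2 eps1); rewrite -[Gamma N eps]trmxK -trmx_mul uG trmx0.
rewrite /tau_s trmxK; split => [<-|->]; first by rewrite mulKmx.
by rewrite mulKVmx.
Qed.

Definition desync_line (R : realType) (N : nat) (tbar eps : R) (s : 'S_N) :
    set 'rV[R]_N :=
  [set x | cube tbar x /\
     exists c : R, x = col_perm s (tau_s N tbar eps) + const_mx c].

Definition desync_set (R : realType) (N : nat) (tbar eps : R) : set 'rV[R]_N :=
  \bigcup_(s in [set: 'S_N]) desync_line tbar eps s.

(* Main.v *)
Require Import Defs.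
From mathcomp Require Import all_boot all_order all_algebra perm ring lra zify.
From mathcomp Require Import all_classical all_reals all_analysis.
From mathcomp Require Import measurable_realfun.

(** Why the theorem holds.

    Record the order of the oscillators in a rank map [s], rank 0 being the
    oscillator closest to the threshold, and let [phase k] be the [k]-th entry
    of [tau_s]. The lines that make up the desynchronization set are the states
    [x] for which the errors [x i - phase (s i)] of all oscillators coincide, so
    the quantity to control is the oscillation of these errors ([spread]). All
    oscillators have the same speed, hence flowing leaves every difference of
    errors unchanged. At a jump the oscillator of rank 0 is reset, the others
    are multiplied by [l = 1 + eps], and all ranks move down by one cyclically.
    Since [phase k = l * phase (k + 1) + phase (N - 1)], every error [e] then
    becomes [l * e - phase (N - 1)], with the same constant for all oscillators:
    the spread is multiplied by exactly [l < 1].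

    A perturbation of size [r = delta * sup rho] changes this picture by a
    bounded multiple of [r] during each flow and each jump
    ([flow_state], [jump_contracts]), so the spread after [j] jumps is at most
    [l ^ j] times the initial one, plus [O(r)] ([solution_state]). Two facts
    make this rigorous. First, the supremum of [rho] can be taken over a bounded
    neighbourhood of the cube, because solutions cannot escape from a much
    smaller one: points just outside of the latter do not belong to the
    perturbed flow set ([confinement]). Secondly, the jump acts as described
    only if a single oscillator is within [O(r)] of the threshold, so the gaps
    between oscillators must stay bounded below. Consecutive gaps are shifted
    cyclically and multiplied by [l] at a jump, and the gap created behind the
    reset oscillator is at least [(1 - l) * tbar], up to [O(r)]; with weights
    decreasing like [(l / 2) ^ n] along the cycle, a lower bound on the gaps is
    therefore preserved with a margin that absorbs the noise ([spaced]). Such a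
    bound holds at the initial time uniformly on a compact subset of the basin
    ([compact_gap]); this is the only place where [delta] depends on it.

    Up to [O(r)], the distance to the desynchronization set is bounded by a
    multiple of the spread ([dist_le_spread]), and the initial spread by a
    multiple of the initial distance ([initial_ranking]). A flow interval cannot
    last longer than a time [T] that depends on [tbar] and [omega] only, so that
    [t + j <= (j + 1) * (T + 1)] and the geometric decay in [j] is an
    exponential decay in [t + j], which gives the comparison function.

    The bounds along the flow need that an absolutely continuous function whose
    derivative is almost everywhere within [m] of [w] has increments within
    [m * (b - a)] of [w * (b - a)] ([derivative_bound_increment]). The
    exceptional null set is covered by an open set of small measure, whose
    contribution is controlled by absolute continuity, and everywhere else the
    derivative controls small increments; the two kinds of steps are chained
    from [a] to [b] by [real_induction]. *)

Set Implicit Arguments.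
Unset Strict Implicit.
Unset Printing Implicit Defensive.

Import Order.TTheory GRing.Theory Num.Theory.
Import numFieldNormedType.Exports.

Local Open Scope classical_set_scope.
Local Open Scope ring_scope.

(** * Euclidean norms and distances *)

Lemma coord_le_enorm (R : realType) (N : nat) (x : 'rV[R]_N) (i : 'I_N) :
  `|x ord0 i| <= enorm x.
Proof.
rewrite -sqrtr_sqr; apply: ler_wsqrtr.
rewrite (bigD1 i) //= lerDl; apply: sumr_ge0 => k _; exact: sqr_ge0.
Qed.

Lemma enorm_ge0 (R : realType) (N : nat) (x : 'rV[R]_N) : 0 <= enorm x.
Proof. exact: sqrtr_ge0. Qed.

Lemma enorm_le_coord (R : realType) (N : nat) (x : 'rV[R]_N) (c : R) :
  0 <= c -> (forall i, `|x ord0 i| <= c) -> enorm x <= N%:R * c.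
Proof.
move=> c0 xc; have Nc0 : 0 <= N%:R * c by rewrite mulr_ge0.
rewrite -[leRHS]ger0_norm // -sqrtr_sqr; apply: ler_wsqrtr.
apply: (@le_trans _ _ (\sum_(i < N) c ^+ 2)).
  apply: ler_sum => i _; rewrite -real_normK ?num_real //.
  by apply: lerXn2r; rewrite ?nnegrE.
rewrite sumr_const card_ord exprMn -[_ *+ N]mulr_natl.
apply: ler_wpM2r; first exact: sqr_ge0.
rewrite -natrX ler_nat; by case: (N) => // n; rewrite leq_pmulr.
Qed.

(** Only this coordinatewise consequence of the Euclidean perturbations is used:
    all estimates below are made oscillator by oscillator. *)
Lemma ball_around_coord (R : realType) (N : nat) (x y : 'rV[R]_N) (r : R) (i : 'I_N) :
  0 <= r -> ball_around x r y -> `|y ord0 i - x ord0 i| <= r.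
Proof.
move=> r0 [b b1 <-]; rewrite /unit_ball /= in b1.
rewrite !mxE addrAC subrr add0r normrM ger0_norm //.
rewrite -[leRHS]mulr1; apply: ler_wpM2l => //.
exact: (le_trans (coord_le_enorm b i) b1).
Qed.

Lemma dist_to_lb (R : realType) (N : nat) (A : set 'rV[R]_N) (x : 'rV[R]_N) :
  has_lbound [set enorm (x - z) | z in A].
Proof. by exists 0 => _ [z _ <-]; exact: enorm_ge0. Qed.

Lemma dist_to_le (R : realType) (N : nat) (A : set 'rV[R]_N) (x z : 'rV[R]_N) :
  A z -> dist_to A x <= enorm (x - z).
Proof. by move=> Az; apply: ge_inf; [exact: dist_to_lb|exists z]. Qed.

Lemma dist_to_ge0 (R : realType) (N : nat) (A : set 'rV[R]_N) (x : 'rV[R]_N) :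
  A !=set0 -> 0 <= dist_to A x.
Proof.
move=> [z Az]; apply: lb_le_inf; first by exists (enorm (x - z)); exists z.
by move=> _ [y _ <-]; exact: enorm_ge0.
Qed.

(** The distance is an infimum. An almost nearest point costs an error [k] that
    can be made as small as the tolerance [alpha] requires. *)
Lemma dist_to_adherent (R : realType) (N : nat) (A : set 'rV[R]_N)
    (x : 'rV[R]_N) (k : R) :
  A !=set0 -> 0 < k -> exists2 z, A z & enorm (x - z) < dist_to A x + k.
Proof.
move=> [z Az] k0.
have [|_ [y Ay <-] lt] := inf_adherent k0 (E := [set enorm (x - z) | z in A]).
  split; [by exists (enorm (x - z)); exists z|exact: dist_to_lb].
by exists y.
Qed.

(** * Absolutely continuous curves *)

(** If [P] can be carried across every point of the interval, it reaches the
    right end: the supremum of the points where [P] holds is itself crossed. This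
    plays the part of a compactness argument on a chain of small steps. *)
Lemma real_induction (R : realType) (a b : R) (P : R -> Prop) :
  a <= b -> P a ->
  (forall t, a <= t <= b -> exists2 h : R, 0 < h &
     forall s u, a <= s -> u <= b -> s <= t <= u -> t - h < s -> u < t + h ->
       P s -> P u) ->
  P b.
Proof.
move=> ab Pa step.
pose A := [set t | a <= t <= b /\ P t].
have supA : has_sup A.
  split; first by exists a; split => //; rewrite lexx ab.
  by exists b => t [/andP[]].
have cle : sup A <= b by apply: ge_sup => [|t [/andP[]//]]; exact: supA.1.
have ac : a <= sup A by apply: ub_le_sup; [exact: supA.2|split => //; rewrite lexx ab].
have [|h h0 H] := step (sup A); first by rewrite ac cle.
have [s [/andP[as_ sb] Ps] hs] := sup_adherent h0 supA.
have sc : s <= sup A by apply: ub_le_sup; [exact: supA.2|split => //; rewrite as_ sb].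
have [lt|ge] := ltP (sup A) b; last first.
  by apply: (H s b) => //; [rewrite sc|lra].
pose u := Num.min b (sup A + h / 2).
have cu : sup A < u by rewrite lt_min lt ltrDl divr_gt0.
have ub : u <= b by rewrite ge_min lexx.
have : u <= sup A.
  apply: ub_le_sup; first exact: supA.2.
  split; first by rewrite ub (le_trans ac (ltW cu)).
  apply: (H s u) => //; first by rewrite sc ltW.
  have : u <= sup A + h / 2 by rewrite ge_min lexx orbT.
  lra.
by rewrite leNgt cu.
Qed.

(** Nondegenerate intervals have positive measure. Together with continuity,
    this turns closed conditions that hold almost everywhere into conditions that
    hold everywhere. *)
Lemma ae_dense (R : realType) (Q : R -> Prop) (a b : R) :
  {ae (@lebesgue_measure R), forall t, Q t} -> a < b ->
  exists2 t, a < t < b & Q t.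
Proof.
move=> [B [mB B0 QB]] ab; apply: contrapT => nex.
have sub : `]a, b[%classic `<=` B.
  move=> t /=; rewrite in_itv /= => abt; apply: QB => /= Qt.
  by apply: nex; exists t.
have : (lebesgue_measure (`]a, b[%classic : set R) <= lebesgue_measure B)%E.
  by apply: le_measure => //; rewrite inE //; exact: measurable_itv.
rewrite lebesgue_measure_itv /= lte_fin ab B0 -EFinB lee_fin; lra.
Qed.

Lemma ae_imply (R : realType) (P Q : R -> Prop) :
  (forall t, P t -> Q t) -> {ae (@lebesgue_measure R), forall t, P t} ->
  {ae (@lebesgue_measure R), forall t, Q t}.
Proof.
move=> PQ [B [mB B0 sB]]; exists B; split => // t nQ; apply: sB.
by move=> /PQ.
Qed.

(** Steps of two kinds lead from [a] to [b]. Around a point where the derivative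
    bound holds, small increments of [g] are within [m + e] of the slope [w].
    Around an exceptional point, small intervals stay inside an open set [U] of
    measure less than [d], and by absolute continuity all such steps together
    change [g] by less than [e]. The predicate [P t] below says that [t] has been
    reached by such steps, the [u i], [v i] being the ends of those in [U]. *)
Lemma derivative_bound_increment (R : realType) (g : R -> R) (a b w m : R) :
  a <= b -> 0 <= m ->
  (forall e : R, 0 < e -> exists2 d : R, 0 < d &
    forall (n : nat) (u v : 'I_n -> R),
      (forall i, [/\ a <= u i, u i <= v i & v i <= b]) ->
      (forall i k, i != k -> v i <= u k \/ v k <= u i) ->
      \sum_(i < n) (v i - u i) < d ->
      \sum_(i < n) `|g (v i) - g (u i)| < e) ->
  {ae (@lebesgue_measure R), forall t : R, a <= t <= b ->
     forall e, 0 < e -> exists2 h, 0 < h &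
       forall u, `|u - t| < h -> `|g u - g t - w * (u - t)| <= (m + e) * `|u - t|} ->
  `|g b - g a - w * (b - a)| <= m * (b - a).
Proof.
move=> ab m0 ac [B [mB B0 QB]].
suff H e : 0 < e -> `|g b - g a - w * (b - a)| <= (m + e) * (b - a) + e + e.
  apply/ler_addgt0Pr => e e0.
  have k0 : 0 < b - a + 2 by lra.
  apply: le_trans (H (e / (b - a + 2)) (divr_gt0 e0 k0)) _.
  by rewrite le_eqVlt; apply/orP; left; apply/eqP; field; rewrite gt_eqF.
move=> e0.
have [d d0 Hd] := ac e e0.
(* The second bound makes the contribution of the slope [w] on [U] at most [e]. *)
pose d' := Num.min d (e / (`|w| + 1)).
have w0 : 0 < `|w| + 1 by rewrite ltr_wpDl.
have d'0 : 0 < d' by rewrite lt_min d0 divr_gt0.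
have [|U [oU BU mU]] := lebesgue_regularity_outer mB _ d'0.
  set X := (X in (X < _)%E); have -> : X = 0%E by exact: B0.
  exact: ltry.
have mUm : measurable U by exact: open_measurable.
have mUd : (lebesgue_measure U < d'%:E)%E.
  have -> : U = B `|` (U `\` B) by rewrite setDUK.
  apply: le_lt_trans mU; apply: le_trans.
    by apply: measureU2 => //; exact: measurableD.
  set X := (X in (X + _)%E); have -> : X = 0%E by exact: B0.
  by rewrite add0e.
pose P t := exists n (u v : nat -> R),
  [/\ forall i, (i < n)%N -> [/\ a <= u i, u i <= v i & v i <= t],
      forall i k, (i < k < n)%N -> v i <= u k,
      ((\sum_(i < n) (v i - u i))%:E <= lebesgue_measure (U `&` `[a, t[))%E &
      `|g t - g a - w * (t - a)| <= (m + e) * (t - a) +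
         \sum_(i < n) (`|g (v i) - g (u i)| + `|w| * (v i - u i))].
have Pb : P b.
  apply: (@real_induction _ a b) => //.
    exists 0%N, (fun=> 0), (fun=> 0); split => //.
      by rewrite big_ord0; exact: measure_ge0.
    by rewrite big_ord0 !subrr !mulr0 addr0 subrr normr0.
  move=> t abt.
  have mono s u : s <= u ->
      (lebesgue_measure (U `&` `[a, s[) <= lebesgue_measure (U `&` `[a, u[))%E.
    move=> su; apply: le_measure; rewrite ?inE; try exact: measurableI.
    apply: setIS => x /=; rewrite !in_itv /= => /andP[-> /=]; lra.
  have [Ut|nUt] := pselect (U t).
    have [h /= h0 hU] := oU t Ut.
    exists h => // s u as_ ub /andP[st tu] hs hu [n [p [q [pq ndis le1 le2]]]].
    exists n.+1, (fun i => if (i < n)%N then p i else s),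
      (fun i => if (i < n)%N then q i else u).
    split.
    - move=> i; rewrite ltnS leq_eqVlt => /orP[/eqP ->|lt].
        by rewrite ltnn; split; lra.
      by rewrite lt; have [? ? ?] := pq _ lt; split; lra.
    - move=> i k /andP[ik]; rewrite ltnS => kn.
      rewrite (leq_trans ik kn).
      move: kn; rewrite leq_eqVlt => /orP[/eqP kn|lt].
        by subst k; rewrite ltnn; have [? ? ?] := pq _ ik.
      by rewrite lt; apply: ndis; rewrite ik.
    - rewrite big_ord_recr /= ltnn.
      rewrite (eq_bigr (fun i : 'I_n => q i - p i)); last first.
          by move=> i _; rewrite ltn_ord.
      have -> : U `&` `[a, u[ = (U `&` `[a, s[) `|` `[s, u[%classic.
        rewrite predeqE => x; split => /=; rewrite !in_itv /=.
          move=> [Ux /andP[ax xu]]; case: (ltP x s) => xs.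
            by left; split => //; exact/andP.
          by right; exact/andP.
        move=> [[Ux /andP[-> /=]]|/andP[sx xu]]; first by split => //; lra.
        split; last by rewrite xu andbT; lra.
        apply: hU; rewrite /= ltr_distlC; apply/andP; split; lra.
      rewrite measureU //; first last.
      + apply/seteqP; split => x //= [[_]]; rewrite !in_itv /=.
        by move=> /andP[_ ?] /andP[? _]; lra.
      + exact: measurableI.
      rewrite EFinD; apply: leeD => //.
      have Lsu : ((u - s)%:E <= lebesgue_measure (`[s, u[%classic : set R))%E.
        rewrite lebesgue_measure_itv /= lte_fin.
        by case: ltP => // su; rewrite ?EFinB // lee_fin; lra.
      exact: Lsu.
    - rewrite big_ord_recr /= ltnn.
      rewrite (eq_bigr (fun i : 'I_n =>
        `|g (q i) - g (p i)| + `|w| * (q i - p i))); last first.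
        by move=> i _; rewrite ltn_ord.
      have H1 : `|g u - g s - w * (u - s)| <= `|g u - g s| + `|w| * (u - s).
        apply: le_trans (ler_normB _ _) _.
        by rewrite lerD2l normrM ler_wpM2l // ger0_norm //; lra.
      have -> : g u - g a - w * (u - a) =
          (g s - g a - w * (s - a)) + (g u - g s - w * (u - s)) by ring.
      apply: le_trans (ler_normD _ _) _.
      have H2 : 0 <= (m + e) * (u - s) by apply: mulr_ge0; lra.
      move: le2 H1; set S := \sum_(i < n) _; lra.
  have [h h0 Hh] : exists2 h, 0 < h & forall u, `|u - t| < h ->
      `|g u - g t - w * (u - t)| <= (m + e) * `|u - t|.
    apply: contrapT => nH; apply: nUt; apply: BU; apply: QB => /= Q.
    exact: nH (Q abt e e0).
  exists h => // s u as_ ub /andP[st tu] hs hu [n [p [q [pq ndis le1 le2]]]].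
  exists n, p, q; split => //.
  - by move=> i /pq[]; split; lra.
  - by apply: le_trans le1 (mono _ _ _); lra.
  have := Hh s; rewrite distrC ger0_norm ?subr_ge0 // => /(_ ltac:(lra)) Hs.
  have := Hh u; rewrite ger0_norm ?subr_ge0 // => /(_ ltac:(lra)) Hu.
  have -> : g u - g a - w * (u - a) =
      (g s - g a - w * (s - a)) - (g s - g t - w * (s - t)) +
      (g u - g t - w * (u - t)) by ring.
  apply: le_trans (ler_normD _ _) _.
  have := ler_normB (g s - g a - w * (s - a)) (g s - g t - w * (s - t)).
  move: le2 Hs Hu; set S := \sum_(i < n) _.
  by lra.
move: Pb => [n [u [v [uv ndis le1 le2]]]].
have lt1 : \sum_(i < n) (v i - u i) < d'.
  rewrite -lte_fin; apply: le_lt_trans le1 (le_lt_trans _ mUd).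
  by apply: le_measure; rewrite ?inE //; exact: measurableI.
move: (lt1); rewrite lt_min => /andP[ltd ltw].
have := Hd n (fun i => u i) (fun i => v i).
have /[swap]/[apply] : forall i : 'I_n, [/\ a <= u i, u i <= v i & v i <= b].
  by move=> i; apply: uv.
have /[swap]/[apply] : forall i k : 'I_n, i != k -> v i <= u k \/ v k <= u i.
  by move=> i k; rewrite neq_ltn => /orP[ik|ki]; [left|right];
    apply: ndis; rewrite ?ik ?ki /=.
move=> /(_ ltd) lt2.
move: le2; rewrite big_split /= -mulr_sumr.
move: lt2 ltw; rewrite ltr_pdivlMr //.
have : 0 <= \sum_(i < n) (v i - u i).
  by apply: sumr_ge0 => i _; have [_ ? _] := uv i (ltn_ord i); rewrite subr_ge0.
set X := \sum_(i < n) (v i - u i); set Y := \sum_(i < n) _.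
by lra.
Qed.

Lemma abs_continuous_uniform (R : realType) (N : nat) (a b : R)
    (f : R -> 'rV[R]_N) (e : R) :
  abs_continuous a b f -> 0 < e -> exists2 d, 0 < d &
    forall s t, a <= s <= b -> a <= t <= b -> `|t - s| < d ->
      enorm (f t - f s) < e.
Proof.
move=> ac e0; have [d d0 H] := ac e e0; exists d => //.
have enormN (y : 'rV[R]_N) : enorm (- y) = enorm y.
  by congr Num.sqrt; apply: eq_bigr => i _; rewrite !mxE sqrrN.
have main s t : a <= s -> t <= b -> s <= t -> `|t - s| < d -> enorm (f t - f s) < e.
  move=> as_ tb st dst.
  have := H 1%N (fun=> s) (fun=> t).
  rewrite !big_ord1; apply.
  - by move=> _; split.
  - by move=> i k; rewrite !ord1.
  - by move: dst; rewrite ger0_norm // subr_ge0.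
move=> s t /andP[as_ sb] /andP[at_ tb] dst.
have [st|/ltW ts] := leP s t; first exact: main.
by rewrite -enormN opprB; apply: main => //; rewrite distrC.
Qed.

Lemma derive1_coord_increment (R : realType) (N : nat) (f : R -> 'rV[R]_N)
    (t w m e : R) (i : 'I_N) :
  derivable f t 1 -> `|derive1 f t ord0 i - w| <= m -> 0 < e ->
  exists2 h, 0 < h & forall u, `|u - t| < h ->
    `|f u ord0 i - f t ord0 i - w * (u - t)| <= (m + e) * `|u - t|.
Proof.
move=> df dm e0.
have /cvg_ex[/= D cD] := df.
have DE : derive1 f t = D by rewrite derive1E; apply: cvg_lim.
rewrite DE in dm.
have cDi : (h^-1 *: (f (h *: 1 + t) - f t)) ord0 i @[h --> 0^'] --> D ord0 i.
  apply: (@continuous_cvg _ _ _ _ _ _ (fun M : 'rV[R]_N => M ord0 i) D _ cD).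
  exact: coord_continuous.
have /cvgr_distC_lt/(_ _ e0) := cDi.
move=> [h /= h0 H]; exists h => // u ut.
have [->|nut] := eqVneq u t; first by rewrite !subrr mulr0 subrr normr0 mulr0.
have ut0 : u - t != 0 by rewrite subr_eq0.
have := H (u - t); rewrite /= sub0r normrN => /(_ ut ut0).
rewrite !mxE [_ *: _]mulr1 subrK => Hu.
have -> : f u ord0 i - f t ord0 i - w * (u - t) =
  (((u - t)^-1 * (f u ord0 i - f t ord0 i) - D ord0 i) + (D ord0 i - w)) * (u - t).
  by field.
rewrite normrM; apply: ler_wpM2r => //.
by apply: le_trans (ler_normD _ _) _; lra.
Qed.

Lemma abs_continuous_drift (R : realType) (N : nat) (f : R -> 'rV[R]_N)
    (a b w m : R) (i : 'I_N) :
  a <= b -> 0 <= m -> abs_continuous a b f ->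
  {ae (@lebesgue_measure R), forall t : R, a <= t <= b ->
     derivable f t 1 /\ `|derive1 f t ord0 i - w| <= m} ->
  `|f b ord0 i - f a ord0 i - w * (b - a)| <= m * (b - a).
Proof.
move=> ab m0 ac aed.
apply: (@derivative_bound_increment _ (fun t => f t ord0 i) a b) => //.
  move=> e e0; have [d d0 H] := ac e e0; exists d => // n u v uv ndis lt.
  apply: le_lt_trans (H n u v uv ndis lt); apply: ler_sum => k _.
  by have := coord_le_enorm (f (v k) - f (u k)) i; rewrite !mxE.
apply: ae_imply aed => t H abt e e0; have [df dm] := H abt.
exact: derive1_coord_increment.
Qed.

(** * Neighbourhoods of the cube *)

Definition thick_cube (R : realType) (N : nat) (tbar r : R) : set 'rV[R]_N :=
  [set x | forall i, - r <= x ord0 i <= tbar + r].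

Lemma thick_cubeS (R : realType) (N : nat) (tbar r r' : R) (x : 'rV[R]_N) :
  r <= r' -> thick_cube tbar r x -> thick_cube tbar r' x.
Proof. by move=> rr cx i; have := cx i; lra. Qed.

Lemma thick_cube_bounded (R : realType) (N : nat) (tbar : R) (rho : 'rV[R]_N -> R) :
  0 < tbar -> continuous rho ->
  exists2 M : R, 1 <= M & forall x, thick_cube tbar 1 x -> rho x <= M.
Proof.
move=> t0 crho.
have cT : compact (@thick_cube R N tbar 1).
  have := @rV_compact R N (fun=> `[- 1, tbar + 1]%classic)
    (fun=> @segment_compact _ _ _).
  congr compact; apply/seteqP; split => x H i; have := H i; rewrite /= in_itv //.
have ne : @thick_cube R N tbar 1 !=set0 by exists 0 => i; rewrite mxE; lra.
have [c _ cmax] := EVT_max_rV ne cT (continuous_subspaceT crho).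
exists (Num.max 1 (rho c)); first by rewrite le_max lexx.
by move=> x xT; rewrite le_max cmax ?orbT // inE.
Qed.

(** The hypothesis leaves a forbidden layer between the cubes thickened by [r]
    and by 1: a curve that starts in the smaller one would have to cross the
    layer continuously, while it avoids it at almost all times. *)
Lemma confinement (R : realType) (N : nat) (tbar r a b : R) (f : R -> 'rV[R]_N) :
  0 <= r < 1 -> a <= b -> abs_continuous a b f ->
  {ae (@lebesgue_measure R), forall t : R, a <= t <= b ->
     thick_cube tbar 1 (f t) -> thick_cube tbar r (f t)} ->
  thick_cube tbar r (f a) -> thick_cube tbar r (f b).
Proof.
move=> /andP[r0 r1] ab ac aeb fa.
have r1' : 0 < 1 - r by lra.
have [d d0 Hd] := abs_continuous_uniform ac r1'.
apply: (@real_induction _ a b (fun t => thick_cube tbar r (f t))) => // t abt.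
exists (d / 2); first by rewrite divr_gt0.
move=> s u as_ ub /andP[st tu] hs hu Ps i.
have nearP v : s <= v <= u -> thick_cube tbar 1 (f v).
  move=> /andP[sv vu] k.
  have := le_lt_trans (coord_le_enorm _ k) (Hd s v _ _ _).
  rewrite !mxE ger0_norm ?subr_ge0 // => /(_ ltac:(lra) ltac:(lra) ltac:(lra)).
  by move: (Ps k); rewrite ltr_norml; lra.
have [us|su] := leP u s; first by have -> : u = s by lra.
suff H e : 0 < e -> - r - e <= f u ord0 i <= tbar + r + e.
  apply/andP; split.
    by rewrite -subr_ge0 opprK; apply/ler_addgt0Pr => e e0; have := H e e0; lra.
  by apply/ler_addgt0Pr => e e0; have := H e e0; lra.
move=> e0; have [d' d'0 Hd'] := abs_continuous_uniform ac e0.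
have [|v /andP[sv vu] Pv] := @ae_dense _ _ (Num.max s (u - d')) u aeb.
  by rewrite gt_max su /=; lra.
move: sv; rewrite gt_max => /andP[sv dv].
have := Pv ltac:(lra) (nearP v ltac:(lra)) i.
have := le_lt_trans (coord_le_enorm _ i) (Hd' v u _ _ _).
rewrite !mxE ger0_norm ?subr_ge0; last exact: ltW.
move=> /(_ ltac:(lra) ltac:(lra) ltac:(lra)).
by rewrite ltr_norml; lra.
Qed.

(** * The points of the desynchronization set *)

Section Desynchronized.
Context (R : realType) (N : nat) (tbar eps : R).
Hypotheses (N2 : (2 <= N)%N) (tbar0 : 0 < tbar) (eps1 : -1 < eps < 0).

Definition geometric_sum (k : nat) : R := \sum_(m < k) (1 + eps) ^+ m.

(** The closed form of [tau_s]: its gaps, including the one from the last entry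
    to 0, form a geometric progression of ratio [1 / (1 + eps)] with sum
    [tbar]. *)
Definition phase (k : nat) : R :=
  tbar * geometric_sum (N - k) / geometric_sum N.

Definition last_phase : R := tbar / geometric_sum N.

Lemma geometric_sumS k :
  geometric_sum k.+1 = 1 + (1 + eps) * geometric_sum k.
Proof.
rewrite /geometric_sum big_ord_recl expr0 big_distrr /=; congr (_ + _).
by apply: eq_bigr => m _; rewrite exprS.
Qed.

Lemma geometric_sum_ge0 k : 0 <= geometric_sum k.
Proof. apply: sumr_ge0 => m _; apply: exprn_ge0; move: eps1; lra. Qed.

Lemma geometric_sum_gt0 : 0 < geometric_sum N.
Proof.
have e1 := eps1.
case: N N2 => // n _; rewrite geometric_sumS ltr_pwDl //.
apply: mulr_ge0; [lra|exact: geometric_sum_ge0].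
Qed.

Lemma last_phase_gt0 : 0 < last_phase.
Proof. by rewrite divr_gt0 // geometric_sum_gt0. Qed.

Lemma phase0 : phase 0 = tbar.
Proof. by rewrite /phase subn0 mulfK // gt_eqF // geometric_sum_gt0. Qed.

Lemma phase_size : phase N = 0.
Proof. by rewrite /phase subnn /geometric_sum big_ord0 mulr0 mul0r. Qed.

(** The desynchronized configuration is reproduced by a jump, up to a shift
    of the ranks and a translation by [last_phase]. *)
Lemma phase_rec k : (k < N)%N -> phase k = (1 + eps) * phase k.+1 + last_phase.
Proof.
move=> kN; rewrite /phase /last_phase -(subnSK kN) geometric_sumS.
set S := geometric_sum (N - k.+1).
by field; rewrite gt_eqF // geometric_sum_gt0.
Qed.

Lemma phase_last : phase N.-1 = last_phase.
Proof.
rewrite phase_rec ?prednK ?phase_size ?mulr0 ?add0r //; lia.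
Qed.

Lemma phase_step k : (k < N)%N ->
  phase k - phase k.+1 = last_phase * (1 + eps) ^+ (N - k.+1).
Proof.
move=> kN; rewrite /phase /last_phase.
have -> : (N - k = (N - k.+1).+1)%N by lia.
rewrite {1}/geometric_sum big_ord_recr /= -/(geometric_sum _).
by field; rewrite gt_eqF // geometric_sum_gt0.
Qed.

Definition phase_gap : R := last_phase * (1 + eps) ^+ N.

Lemma phase_gap_gt0 : 0 < phase_gap.
Proof. by rewrite mulr_gt0 ?last_phase_gt0 // exprn_gt0 //; move: eps1; lra. Qed.

Lemma phase_gap_le k r : (k < r)%N -> (r <= N)%N ->
  phase_gap <= phase k - phase r.
Proof.
have e1 := eps1.
have l0 := last_phase_gt0.
have step m : (m < N)%N -> phase_gap <= phase m - phase m.+1.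
  move=> mN; rewrite phase_step // ler_pM2l //.
  by apply: ler_wiXn2l; [lra|lra|lia].
elim: r => // r IH; rewrite ltnS leq_eqVlt => /orP[/eqP ->|kr] rN; first exact: step.
have := IH kr (ltnW rN); have := step r rN; have := phase_gap_gt0; lra.
Qed.

Lemma phase_le k r : (k <= r)%N -> (r <= N)%N -> phase r <= phase k.
Proof.
rewrite leq_eqVlt => /orP[/eqP -> //|kr rN].
by have := phase_gap_le kr rN; have := phase_gap_gt0; lra.
Qed.

Lemma phase_bounds (i : 'I_N) : last_phase <= phase i <= tbar.
Proof.
rewrite -phase0 -phase_last; apply/andP; split; apply: phase_le => //.
- by have := ltn_ord i; lia.
- lia.
- exact: ltnW.
Qed.

Lemma tau_sE (i : 'I_N) : tau_s N tbar eps ord0 i = phase i.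
Proof.
have e1 := eps1.
suff /tau_sP : Gamma N eps *m (\col_j phase j) = const_mx tbar :> 'cV[R]_N.
  move=> /(_ N2 ltac:(lra)) /colP/(_ i); rewrite !mxE => ->.
  by [].
have sumE (k : nat) (c : R) : (k <= N)%N ->
    \sum_(j < N) (if j == k :> nat then c else 0) * phase j = c * phase k.
  rewrite leq_eqVlt => /orP[/eqP ->|kn].
    rewrite phase_size mulr0 big1 // => j _.
    by rewrite ltn_eqF ?mul0r.
  rewrite (bigD1 (Ordinal kn)) //= eqxx big1 ?addr0 // => j jk.
  by rewrite ifN ?mul0r.
apply/colP => k; rewrite !mxE.
under eq_bigr do rewrite !mxE.
have l1 : (1 + eps) * phase 1 = tbar - last_phase.
  have := @phase_rec 0 ltac:(lia); rewrite phase0; lra.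
case: k => -[|[|k]] kN /=.
- by rewrite -[in RHS]phase0 -[RHS]mul1r -sumE //.
- have E := @phase_rec 1%N kN.
  transitivity ((1 + (1 + eps)) * phase 1 - (1 + eps) * phase 2); last lra.
  rewrite -mulNr -!sumE //; last lia.
  rewrite -big_split /=; apply: eq_bigr => j _.
  by case: (nat_of_ord j) => [|[|[|m]]] /=; ring.
- have E := @phase_rec k.+2 kN.
  transitivity ((1 + eps) * phase 1 + 1 * phase k.+2 - (1 + eps) * phase k.+3);
    last lra.
  rewrite -mulNr -!sumE //; [|lia|lia].
  rewrite -!big_split /=; apply: eq_bigr => j _.
  have [->|j1] := eqVneq (nat_of_ord j) 1%N; first by rewrite /=; ring.
  have [->|jk] := eqVneq (nat_of_ord j) k.+2; last by rewrite !mul0r !add0r.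
  by rewrite ltn_eqF //=; ring.
Qed.

(** * Contraction of the desynchronization error at jumps *)

(** The bound [E] on the oscillation of the errors is the Lyapunov function. A
    state of the cube has spread 0 exactly when it lies on the line of the
    desynchronization set with rank map [s]. *)
Definition spread (s : 'S_N) (x : 'rV[R]_N) (E : R) : Prop :=
  forall i r, `|(x ord0 i - phase (s i)) - (x ord0 r - phase (s r))| <= E.

(** Gaps in the cyclic order. The lower bound depends on the number of jumps
    that remain before the oscillator [r] is reset. The upper bound is a lower
    bound on the last gap of the cycle, through the reset. The margin [n] is what
    the noise may consume during a flow. The ratio [(1 + eps) / 2] is smaller than
    the factor [1 + eps] of a jump, so that a jump restores a zero margin. *)
Definition spaced (s : 'S_N) (x : 'rV[R]_N) (mu n : R) : Prop :=
  forall i r : 'I_N, (s i < s r)%N ->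
    mu * ((1 + eps) / 2) ^+ (N - s r) - n <= x ord0 i - x ord0 r <= tbar - mu + n.

Definition next_rank (s : 'S_N) : 'S_N := (s * perm (@ord_pred_inj N))%g.

Lemma next_rankE (s : 'S_N) (i : 'I_N) :
  next_rank s i = (if s i == 0%N :> nat then N.-1 else (s i).-1) :> nat.
Proof.
rewrite permM permE /=; have := ltn_ord (s i).
case: (nat_of_ord (s i)) => [|k] kN /=; first by rewrite add0n modn_small //; lia.
by rewrite ?addSn /= modnDr modn_small //; lia.
Qed.

(** The gaps exceed the noise, so the perturbed point [y] at which the jump map
    is evaluated has exactly one component at the threshold. The set-valued cases
    of the jump map are thus excluded. *)
Lemma leading_component (s : 'S_N) (x y g : 'rV[R]_N) (mu n r : R) :
  0 < mu -> 
  n + 2 * r < mu * ((1 + eps) / 2) ^+ N ->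
  spaced s x mu n ->
  threshold_set tbar y -> (forall i, `|y ord0 i - x ord0 i| <= r) ->
  (forall i, component_jump tbar eps y i (g ord0 i)) ->
  forall i, if s i == 0%N :> nat then y ord0 i = tbar /\ g ord0 i = 0
            else g ord0 i = (1 + eps) * y ord0 i.
Proof.
have e1 := eps1; have t0 := tbar0.
move=> mu0 small sp [cy [q yq]] yx gy.
have N0 : (0 < N)%N by lia.
pose p := (s^-1)%g (Ordinal N0).
have sp0 : s p = 0%N :> nat by rewrite /p permKV.
have top i : i != p -> y ord0 i < y ord0 p.
  move=> ip; have si : (s p < s i)%N.
    rewrite sp0 lt0n; apply: contra ip => /eqP si0; apply/eqP.
    by apply: (@perm_inj _ s); apply: val_inj; rewrite /= sp0.
  have /andP[+ _] := sp _ _ si.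
  have : mu * ((1 + eps) / 2) ^+ N <= mu * ((1 + eps) / 2) ^+ (N - s i).
    by rewrite ler_pM2l //; apply: ler_wiXn2l; [lra|lra|lia].
  by move: (yx i) (yx p); rewrite !ler_norml; lra.
have pq : p = q.
  apply/eqP/contraT; rewrite eq_sym => /top; rewrite yq.
  by have /andP[_] := cy p; rewrite leNgt => /negP.
subst q; move=> i; have [si0|si0] := eqVneq (s i : nat) 0%N.
  have -> : i = p by apply: (@perm_inj _ s); apply: val_inj; rewrite /= sp0.
  split => //; case: (gy p) => [[_ _ //]|[_ [r' /top + yr] _]|[+ _ _]].
    by rewrite yr yq ltxx.
  by rewrite yq ltxx.
have ip : i != p by apply: contraNneq si0 => ->; rewrite sp0.
have yi : y ord0 i < tbar by rewrite -yq top.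
by case: (gy i) => [[yi' _ _]|[yi' _ _]|[_ _ //]]; rewrite yi' ltxx in yi.
Qed.

(** Each error [e] becomes [(1 + eps) * e - last_phase], up to [2 * r]: this is
    [phase_rec] for the oscillators that are not reset, and for the one that is
    reset it holds because its error is within [r] of 0 when it jumps. The common
    constant disappears from the differences. *)
Lemma jump_contracts (s : 'S_N) (x x' y g : 'rV[R]_N) (mu n r E : R) :
  0 < mu -> 0 <= r -> 0 <= n -> 
  n + 4 * r < (1 + eps) / 2 * (mu * ((1 + eps) / 2) ^+ N) ->
  mu + 2 * r <= - eps * tbar ->
  spread s x E -> spaced s x mu n ->
  threshold_set tbar y -> (forall i, `|y ord0 i - x ord0 i| <= r) ->
  (forall i, component_jump tbar eps y i (g ord0 i)) ->
  (forall i, `|x' ord0 i - g ord0 i| <= r) ->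
  spread (next_rank s) x' ((1 + eps) * E + 4 * r) /\
  spaced (next_rank s) x' mu 0.
Proof.
have e1 := eps1; have t0 := tbar0.
move=> mu0 r0 n0 H1 H2 spr spa thy yx gy xg.
set th := (1 + eps) / 2 in H1 *.
have th01 : 0 < th < 1 by rewrite /th; lra.
have w0 k : 0 < mu * th ^+ k by rewrite mulr_gt0 // exprn_gt0; lra.
have H1' : n + 2 * r < mu * th ^+ N.
  have : th * (mu * th ^+ N) <= 1 * (mu * th ^+ N).
    by apply: ler_wpM2r; [exact: ltW|lra].
  lra.
have lead := leading_component mu0 H1' spa thy yx gy.
have phase_pred (i : 'I_N) : s i != 0%N :> nat ->
    phase (s i).-1 = (1 + eps) * phase (s i) + last_phase.
  have := ltn_ord (s i); case: (nat_of_ord (s i)) => // k kN _.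
  by rewrite phase_rec // ltnW.
have cy := thy.1.
have lr i : - r <= (1 + eps) * (y ord0 i - x ord0 i) <= r.
  rewrite -ler_norml normrM gtr0_norm; last lra.
  by have := yx i; have : 0 <= `|y ord0 i - x ord0 i| by []; nra.
split.
  pose e i := x' ord0 i - phase (next_rank s i) -
     ((1 + eps) * (x ord0 i - phase (s i)) - last_phase).
  have He i : - (2 * r) <= e i <= 2 * r.
    move: (lead i) (xg i) (lr i); rewrite /e next_rankE.
    rewrite !ler_norml; case: eqP => [si0|/eqP si0].
      rewrite si0 phase_last phase0 => -[-> ->]; lra.
    rewrite phase_pred // => ->; lra.
  move=> i k; have := spr i k; have := He i; have := He k; rewrite /e.
  set a := x' ord0 i - _; set b := x' ord0 k - _.
  set c := x ord0 i - _; set d := x ord0 k - _.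
  rewrite !ler_norml => ? ? ?.
  have : - ((1 + eps) * E) <= (1 + eps) * (c - d) <= (1 + eps) * E.
    rewrite -mulrN !ler_pM2l; lra.
  lra.
have l0 : 0 < 1 + eps by lra.
pose X j := (1 + eps) * x ord0 j; pose Y j := (1 + eps) * y ord0 j.
pose T := (1 + eps) * tbar.
have YX j : - r <= Y j - X j <= r by rewrite -mulrBr.
have Y01 j : 0 <= Y j <= T.
  by have /andP[y0 y1] := cy j; rewrite /Y /T ler_pM2l // mulr_ge0 // ltW.
have lth : 1 + eps = 2 * th by rewrite /th; lra.
have ln : (1 + eps) * n <= n by rewrite -[leRHS]mul1r ler_wpM2r //; lra.
have Xspa i k : (s i < s k)%N ->
    2 * (th * (mu * th ^+ (N - s k))) - n <= X i - X k <= T - 2 * (th * mu) + n.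
  have tw a : 2 * (th * a) = (1 + eps) * a by rewrite lth mulrA.
  move=> /spa /andP[G1 G2]; rewrite /X /T -mulrBr !tw -/th in G1 *.
  apply/andP; split.
    apply: le_trans (_ : (1 + eps) * (mu * th ^+ (N - s k) - n) <= _).
      by rewrite mulrBr lerD2l lerN2.
    by rewrite ler_pM2l.
  apply: (@le_trans _ _ ((1 + eps) * (tbar - mu + n))); first by rewrite ler_pM2l.
  by rewrite mulrDr mulrBr lerD2l.
have {}lead i : if s i == 0%N :> nat then Y i = T /\ g ord0 i = 0 else g ord0 i = Y i.
  by have := lead i; rewrite /Y /T; case: eqP => // _ [-> ->].
have wN k' : (k' <= N)%N -> th * (mu * th ^+ N) <= th * (mu * th ^+ k').
  move=> ?; rewrite ler_pM2l; last lra.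
  by rewrite ler_pM2l //; apply: ler_wiXn2l => //; lra.
have {}H2 : mu + 2 * r <= tbar - T by rewrite /T; lra.
move=> i k; rewrite !next_rankE subr0 addr0 -/th.
clearbody X Y T th.
clear yx gy lr spr spa thy cy H1' phase_pred w0 ln lth l0 e1 t0 n0 th01.
have sk := ltn_ord (s k); have si := ltn_ord (s i).
move: (lead i) (lead k) (xg i) (xg k); rewrite !ler_norml.
case: eqP => [si0|/eqP si0]; first by move=> _ _ _ _; clear -si0 sk; case: eqP; lia.
case: eqP => [sk0|/eqP sk0] gi.
  move=> [yk gk] + + _.
  have -> : (N - N.-1 = 1)%N by lia.
  move: (Xspa k i ltac:(rewrite sk0; lia)) (YX i) (YX k) (Y01 i) (wN 0%N isT).
  rewrite gi gk yk expr0 expr1 mulr1.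
  clear -H1 H2 r0 mu0; lra.
move=> gk + + ik.
have sik : (s i < s k)%N by lia.
have -> : (N - (s k).-1 = (N - s k).+1)%N by lia.
move: (Xspa i k sik) (YX i) (YX k) (Y01 i) (Y01 k) (wN (N - s k)%N (leq_subr _ _)).
rewrite gi gk exprS.
set W := th ^+ (N - s k); clear -H1 H2 r0 mu0.
rewrite [mu * (th * W)]mulrCA; lra.
Qed.

(** * Error, distance and initial ranking *)

Lemma desync_setP (z : 'rV[R]_N) :
  desync_set tbar eps z <->
  cube tbar z /\ exists (s : 'S_N) (c : R), forall i, z ord0 i = phase (s i) + c.
Proof.
have lineE (s : 'S_N) c i :
    (col_perm s (tau_s N tbar eps) + const_mx c) ord0 i = phase (s i) + c.
  by rewrite mxE [col_perm _ _ _ _]mxE tau_sE [const_mx _ _ _]mxE.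
split=> [[s _ [cz [c zE]]]|[cz [s [c zE]]]].
  by split => //; exists s, c => i; rewrite zE lineE.
by exists s => //; split => //; exists c; apply/rowP => i; rewrite lineE zE.
Qed.

Lemma desync_set_nonempty : @desync_set R N tbar eps !=set0.
Proof.
exists (\row_i phase i); apply/desync_setP; split.
  move=> i; rewrite mxE; have := phase_bounds i; have := last_phase_gt0; lra.
by exists 1%g, 0 => i; rewrite mxE perm1 addr0.
Qed.

(** The state is compared with the point of its line that has the same leading
    component, moved along the line to the nearest end when that point falls
    outside of the cube. *)
Lemma dist_le_spread (s : 'S_N) (x : 'rV[R]_N) (r E : R) :
  0 <= r -> thick_cube tbar r x -> spread s x E ->
  dist_to (desync_set tbar eps) x <= N%:R * (2 * E + r).
Proof.
have e1 := eps1; have t0 := tbar0.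
move=> r0 cx sx.
have N0 : (0 < N)%N by lia.
have NN : (N.-1 < N)%N by lia.
have E0 : 0 <= E by have := sx (Ordinal N0) (Ordinal N0); rewrite subrr normr0.
pose p := (s^-1)%g (Ordinal N0); pose q := (s^-1)%g (Ordinal NN).
(* [phase (s i) + c] stays in the cube if and only if [c] is in
   [[- last_phase, 0]]. *)
pose c := Num.max (- last_phase) (Num.min 0 (x ord0 p - tbar)).
have cb : - last_phase <= c <= 0.
  by rewrite le_max lexx /= ge_max oppr_le0 ltW ?last_phase_gt0 // ge_min lexx.
pose z := \row_i (phase (s i) + c).
have cp : `|x ord0 p - tbar - c| <= E + r.
  have := sx q p; rewrite !permKV /= phase0 phase_last.
  have := cx p; have := cx q; have := last_phase_gt0; rewrite !ler_norml /c.
  have [a0|a0] := leP 0 (x ord0 p - tbar).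
    by rewrite max_r; lra.
  by have [a1|a1] := leP (- last_phase) (x ord0 p - tbar); lra.
apply: (@le_trans _ _ (enorm (x - z))).
  apply: dist_to_le; apply/desync_setP; split; last by exists s, c => i; rewrite mxE.
  by move=> i; rewrite mxE; have := phase_bounds (s i); lra.
apply: enorm_le_coord; first lra.
move=> i; rewrite !mxE; have := sx i p; move: cp.
by rewrite !permKV /= phase0 !ler_norml; lra.
Qed.

(** The rank of a component is the number of larger ones. *)
Lemma ranking (x : 'rV[R]_N) :
  (forall i r, i != r -> x ord0 i != x ord0 r) ->
  exists s : 'S_N, forall i r, (s i < s r)%N -> x ord0 r < x ord0 i.
Proof.
move=> xinj.
pose rk i := #|[set k | x ord0 i < x ord0 k]%SET|.
have rk_lt i r : x ord0 r < x ord0 i -> (rk i < rk r)%N.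
  move=> ri; apply: proper_card; apply/properP; split.
    by apply/fintype.subsetP => k; rewrite !inE; exact: lt_trans.
  by exists i; rewrite !inE ?ltxx.
have rkN i : (rk i < N)%N.
  rewrite -[X in (_ < X)%N]card_ord -cardsT; apply: proper_card; apply/properP; split.
    by apply/fintype.subsetP => k; rewrite inE.
  by exists i; rewrite !inE ?ltxx.
have rk_inj : injective (fun i => Ordinal (rkN i)).
  move=> i r [e]; apply/eqP; apply: contraT => /xinj.
  by rewrite neq_lt => /orP[] /rk_lt; rewrite e ltnn.
exists (perm rk_inj) => i r; rewrite !permE /= => lt.
have [//|] := ltP (x ord0 r) (x ord0 i); rewrite le_eqVlt => /orP[/eqP e|/rk_lt lt2].
  by move: lt; rewrite /rk e ltnn.
by move: lt; rewrite ltnNge (ltnW lt2).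
Qed.

(** If [x] is close to a point of the desynchronization set, the two are ordered
    in the same way, because the entries of that point are at least [phase_gap]
    apart, and the spread is at most twice the distance. Otherwise any spread is
    at most [2 * tbar], which is a multiple of the distance. *)
Lemma initial_ranking (x : 'rV[R]_N) (mu k : R) :
  0 < k -> 0 < mu -> cube tbar x ->
  (forall i r, i != r -> mu <= `|x ord0 i - x ord0 r| <= tbar - mu) ->
  exists2 s : 'S_N,
    spread s x ((2 + 4 * tbar / phase_gap) * (dist_to (desync_set tbar eps) x + k)) &
    spaced s x mu 0.
Proof.
have e1 := eps1; have t0 := tbar0.
move=> k0 mu0 cx gap.
have g0 := phase_gap_gt0.
have spaced_of (s : 'S_N) :
    (forall i r, (s i < s r)%N -> x ord0 r < x ord0 i) -> spaced s x mu 0.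
  move=> sx i r ir; have d0 : 0 <= x ord0 i - x ord0 r by rewrite subr_ge0 ltW // sx.
  have /gap : i != r by apply: contraTneq ir => ->; rewrite ltnn.
  rewrite ger0_norm // subr0 addr0 => /andP[le1 ->]; rewrite andbT.
  apply: le_trans le1; rewrite -[leRHS]mulr1 ler_pM2l //; apply: exprn_ile1; lra.
have [z /desync_setP[cz [s [c zE]]] xz] := dist_to_adherent x desync_set_nonempty k0.
set D := dist_to _ x + k in xz *.
have xzi i : `|x ord0 i - z ord0 i| <= enorm (x - z).
  by have := coord_le_enorm (x - z) i; rewrite !mxE.
have n0 := enorm_ge0 (x - z).
have tg0 : 0 <= 4 * tbar / phase_gap by rewrite divr_ge0 ?ltW // mulr_gt0.
have [close|far] := ltP (enorm (x - z)) (phase_gap / 2).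
  exists s.
    move=> i r; have : 0 <= 4 * tbar / phase_gap * D by rewrite mulr_ge0 //; lra.
    rewrite mulrDl; have := xzi i; have := xzi r; rewrite !zE !ler_norml; lra.
  apply: spaced_of => i r ir.
  have := phase_gap_le ir (ltnW (ltn_ord _)).
  have := xzi i; have := xzi r; rewrite !zE !ler_norml; lra.
have [|s' s'x] := @ranking x.
  move=> i r /gap; rewrite -subr_eq0 -normr_gt0; lra.
exists s'; last exact: spaced_of.
move=> i r; apply: (@le_trans _ _ (2 * tbar)).
  have := cx i; have := cx r; have := phase_bounds (s' i); have := phase_bounds (s' r).
  have := last_phase_gt0; rewrite ler_norml; lra.
have : 4 * tbar / phase_gap * (phase_gap / 2) <= 4 * tbar / phase_gap * D.
  by apply: ler_wpM2l => //; lra.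
have -> : 4 * tbar / phase_gap * (phase_gap / 2) = 2 * tbar by field; rewrite gt_eqF.
rewrite mulrDl; lra.
Qed.

(** In the cube, [`|x i - x r|] vanishes only on the synchronization set, and
    apart from that reaches [tbar] only if one component is 0 and the other
    [tbar]. Both cases are excluded from the basin, so the continuous functions
    [`|x i - x r|] and [tbar - `|x i - x r|] are bounded below on [K]. *)
Lemma compact_gap (K : set 'rV[R]_N) :
  compact K -> K `<=` cube tbar `\` bad_set tbar ->
  exists2 mu : R, 0 < mu & forall x, K x ->
    forall i r, i != r -> mu <= `|x ord0 i - x ord0 r| <= tbar - mu.
Proof.
move=> cK Kb.
have pair (q : 'I_N * 'I_N) : exists mu : R, 0 < mu /\ forall x, K x ->
    q.1 != q.2 -> mu <= `|x ord0 q.1 - x ord0 q.2| <= tbar - mu.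
  have [[x0 Kx0]|K0] := pselect (K !=set0); last first.
    by exists 1; split => // x Kx; exfalso; apply: K0; exists x.
  pose f (x : 'rV[R]_N) : R :=
    Num.min `|x ord0 q.1 - x ord0 q.2| (tbar - `|x ord0 q.1 - x ord0 q.2|).
  have cf : continuous f.
    have cd : continuous (fun x : 'rV[R]_N => `|x ord0 q.1 - x ord0 q.2|).
      have cc i : continuous (fun x : 'rV[R]_N => x ord0 i).
        exact: (@coord_continuous _ _ _ ord0 i).
      by move=> x; exact: (cvg_norm (cvgB (cc q.1 x) (cc q.2 x))).
    move=> x; apply: (@continuous_min _ _ _ _ x); first exact: cd.
    by have ct := @cst_continuous _ _ tbar x; exact: (cvgB ct (cd x)).
  have Kne : K !=set0 by exists x0.
  have [c + cmin] := EVT_min_rV Kne cK (continuous_subspaceT cf).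
  rewrite inE => Kc; have [q12|q12] := eqVneq q.1 q.2; first by exists 1.
  exists (f c); split.
    have [cc nb] := Kb _ Kc.
    have ne : c ord0 q.1 != c ord0 q.2.
      by apply/eqP => e; apply: nb; left; split => //; exists q.1, q.2.
    rewrite /f lt_min normr_gt0 subr_eq0 ne /= subr_gt0.
    have [//|ge] := ltP `|c ord0 q.1 - c ord0 q.2| tbar.
    have ns : ~ sync_set tbar c by move=> h; apply: nb; left.
    exfalso; apply: nb; right.
    have := cc q.1; have := cc q.2.
    have [lt|lt] := ltP (c ord0 q.1) (c ord0 q.2).
      move: ge; rewrite ler0_norm; last by rewrite subr_le0 ltW.
      move=> ge b1 b2; split; first by split => //; split => //; exists q.2; lra.
      by exists q.1, q.2; split => //; lra.
    move: ge; rewrite ger0_norm ?subr_ge0 // => ge b1 b2.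
    split; first by split => //; split => //; exists q.1; lra.
    by exists q.2, q.1; split; [rewrite eq_sym|lra|lra].
  move=> x Kx _; have := cmin x (mem_set Kx); rewrite {2}/f le_min; lra.
have [m mP] := choice pair.
exists (\big[Num.min/1]_q m q); first by apply: lt_bigmin => // q _; case: (mP q).
move=> x Kx i r ir; have := (mP (i, r)).2 x Kx ir => /=.
have : \big[Num.min/1]_q m q <= m (i, r) by exact: bigmin_le.
lra.
Qed.

End Desynchronized.

(** * Solutions of the perturbed system *)

(** The last flow interval is cut at [t], so that the arc up to [(t, j)] is
    described by closed intervals that all lie in the domain. *)
Lemma hybrid_time_domain_jumps (R : realType) (S : set (R * nat)) (t : R) (j : nat) :
  hybrid_time_domain S -> S (t, j) ->
  exists tt : nat -> R, [/\ tt 0%N = 0, tt j.+1 = t,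
    forall k, (k <= j)%N -> tt k <= tt k.+1 &
    forall k s, (k <= j)%N -> tt k <= s <= tt k.+1 -> S (s, k)].
Proof.
move=> [S0 Sc] Stj; have [J [tt [tt0 ttS SE]]] := Sc _ _ Stj.
have t0 : 0 <= t := S0 _ Stj.
have : (S `&` [set p | 0 <= p.1 <= t /\ (p.2 <= j)%N]) (t, j).
  by split => //=; rewrite t0 lexx leqnn.
rewrite SE => -[/= jJ /andP[_ tle]].
exists tt; split => //.
- apply/eqP; rewrite eq_le tle andbT.
  have : [set p | (p.2 < J)%N /\ tt p.2 <= p.1 <= tt p.2.+1] (tt j.+1, j).
    by split => //=; rewrite ttS //= lexx.
  by rewrite -SE => -[_ [/andP[_ ->]]].
- by move=> k kj; apply: ttS; apply: leq_ltn_trans kj jJ.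
- move=> k s kj ks.
  have : [set p | (p.2 < J)%N /\ tt p.2 <= p.1 <= tt p.2.+1] (s, k).
    by split => //=; apply: leq_ltn_trans kj jJ.
  by rewrite -SE => -[].
Qed.

(** The level [F] is the fixed point of the noisy contraction, with some margin:
    one flow adds [2 * r * T] to the spread, and one jump [4 * r]. *)
Lemma noise_absorbed (R : realType) (e X F r T : R) :
  - e * F = r * (2 * T + 4) -> 0 <= - e * (r * T) ->
  (1 + e) * (X + F + 2 * r * T) + 4 * r <= (1 + e) * X + F.
Proof. lra. Qed.

Section PerturbedSolution.
Context (R : realType) (N : nat) (tbar omega eps : R) (rho : 'rV[R]_N -> R).
Context (delta M : R) (tau : hybrid_trajectory R N).
Hypotheses (N2 : (2 <= N)%N) (tbar0 : 0 < tbar) (omega0 : 0 < omega).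
Hypotheses (eps1 : -1 < eps < 0) (rho0 : forall x, 0 <= rho x) (delta0 : 0 < delta).
Hypotheses (M1 : 1 <= M) (rhoM : forall x, thick_cube tbar 1 x -> rho x <= M).
Hypothesis sol : is_solution
  (perturbation (impulsive_oscillators N tbar omega eps) (fun x => delta * rho x)) tau.

Let r := delta * M.
Let T := 2 * (tbar + 1) / omega.

Hypotheses (r_half : r <= 1 / 2) (r_omega : r <= omega / 2).

Let r0 : 0 <= r.
Proof. by rewrite mulr_ge0 ?(le_trans _ M1) // ltW. Qed.

Let noise_ge0 x : 0 <= delta * rho x.
Proof. by rewrite mulr_ge0 // ltW. Qed.

Let noise_le x : thick_cube tbar 1 x -> delta * rho x <= r.
Proof. by move=> /rhoM; rewrite ler_pM2l. Qed.

Lemma cube_approx (x y : 'rV[R]_N) : thick_cube tbar 1 x ->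
  ball_around x (delta * rho x) y -> forall i, `|y ord0 i - x ord0 i| <= r.
Proof.
move=> x1 xy i; apply: le_trans (noise_le x1).
exact: ball_around_coord (noise_ge0 x) xy.
Qed.

Lemma flow_confined (k : nat) (a b : R) :
  a <= b -> (forall s, a <= s <= b -> arc_dom tau (s, k)) ->
  thick_cube tbar r (tau a k) ->
  forall s, a <= s <= b -> thick_cube tbar r (tau s k).
Proof.
move=> ab dom ca s /andP[as_ sb]; have [[_ lac] _ _ flow _] := sol.
have r1 : 0 <= r < 1 by have := r0; have := r_half; lra.
have ac : abs_continuous a s (tau^~ k).
  apply: lac => u /=; rewrite in_itv /= => /andP[au us]; apply: dom; lra.
apply: (confinement r1 as_ ac _ ca).
apply: ae_imply (flow k) => u H aus u1.
have [[y [/= xy cy]] _ _] := H (dom u ltac:(lra)).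
move=> i; have := cube_approx u1 xy i; have := cy i.
rewrite ler_norml; lra.
Qed.

Lemma flow_drift (k : nat) (a b : R) (i : 'I_N) :
  a <= b -> (forall s, a <= s <= b -> arc_dom tau (s, k)) ->
  thick_cube tbar r (tau a k) ->
  `|tau b k ord0 i - tau a k ord0 i - omega * (b - a)| <= r * (b - a).
Proof.
move=> ab dom ca; have [[_ lac] _ _ flow _] := sol.
have ac : abs_continuous a b (tau^~ k).
  by apply: lac => u /=; rewrite in_itv /= => ?; apply: dom.
apply: (abs_continuous_drift ab r0 ac).
apply: ae_imply (flow k) => u H aub; have [_ du [f /= -> fu]] := H (dom u aub).
split=> //; apply: le_trans (noise_le (thick_cubeS _ (flow_confined ab dom ca aub))).
  have := ball_around_coord i (noise_ge0 _) fu.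
  by rewrite [const_mx _ _ _]mxE.
have := r_half; lra.
Qed.

Lemma T_ge0 : 0 <= T.
Proof. by rewrite /T divr_ge0 ?mulr_ge0 ?addr_ge0 // ltW. Qed.

(** Every component advances at least at speed [omega / 2] and remains within
    1/2 of the cube. *)
Lemma flow_duration (k : nat) (a b : R) :
  a <= b -> (forall s, a <= s <= b -> arc_dom tau (s, k)) ->
  thick_cube tbar r (tau a k) -> b - a <= T.
Proof.
move=> ab dom ca; have N0 : (0 < N)%N by lia.
have cb := flow_confined ab dom ca (s := b) ltac:(lra).
have := flow_drift (Ordinal N0) ab dom ca.
have := ca (Ordinal N0); have := cb (Ordinal N0).
have : 0 <= (omega / 2 - r) * (b - a).
  by rewrite mulr_ge0 // subr_ge0.
rewrite ler_norml /T ler_pdivlMr //; have := r_half; lra.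
Qed.

Lemma flow_state (k : nat) (a b E mu : R) (s : 'S_N) :
  a <= b -> (forall u, a <= u <= b -> arc_dom tau (u, k)) ->
  thick_cube tbar r (tau a k) ->
  spread tbar eps s (tau a k) E -> spaced tbar eps s (tau a k) mu 0 ->
  spread tbar eps s (tau b k) (E + 2 * r * T) /\
  spaced tbar eps s (tau b k) mu (2 * r * T).
Proof.
move=> ab dom ca spr spa.
have drift i : `|tau b k ord0 i - tau a k ord0 i - omega * (b - a)| <= r * T.
  apply: le_trans (flow_drift i ab dom ca) _.
  by apply: ler_wpM2l r0 _ _ _; apply: flow_duration dom ca.
split=> i q.
  have := drift i; have := drift q; have := spr i q; rewrite !ler_norml; lra.
move=> /spa; have := drift i; have := drift q; rewrite subr0 addr0 !ler_norml; lra.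
Qed.

Lemma jump_state (k : nat) (t E mu : R) (s : 'S_N) :
  0 < mu ->
  2 * r * T + 4 * r < (1 + eps) / 2 * (mu * ((1 + eps) / 2) ^+ N) ->
  mu + 2 * r <= - eps * tbar ->
  arc_dom tau (t, k) -> arc_dom tau (t, k.+1) ->
  thick_cube tbar r (tau t k) ->
  spread tbar eps s (tau t k) E -> spaced tbar eps s (tau t k) mu (2 * r * T) ->
  [/\ thick_cube tbar r (tau t k.+1),
      spread tbar eps (next_rank s) (tau t k.+1) ((1 + eps) * E + 4 * r) &
      spaced tbar eps (next_rank s) (tau t k.+1) mu 0].
Proof.
move=> mu0 H1 H2 domk domk1 ct spr spa.
have t0 := tbar0; have e1 := eps1; have r0' := r0; have rh := r_half.
have [_ _ _ _ jump] := sol.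
have [_ [g [y [xy thy] gy] gx]] := jump _ _ domk domk1.
have r1 : r <= 1 by lra.
have yx := cube_approx (thick_cubeS r1 ct) xy.
have g01 : thick_cube tbar 0 g.
  move=> i; have /andP[y0 y1] := thy.1 i.
  have ly : 0 <= (1 + eps) * y ord0 i <= tbar.
    rewrite mulr_ge0 //=; last lra.
    by apply: le_trans y1; rewrite -[leRHS]mul1r ler_wpM2r //; lra.
  by case: (gy i) => [[_ _ ->]|[_ _ [->|->]]|[_ _ ->]]; lra.
have xg := cube_approx (thick_cubeS ler01 g01) gx.
have n0 : 0 <= 2 * r * T by apply: mulr_ge0; [apply: mulr_ge0|exact: T_ge0].
have [sp1 sp2] := jump_contracts N2 tbar0 eps1 mu0 r0 n0 H1 H2 spr spa thy yx gy xg.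
split => // i; have := g01 i; have := xg i; rewrite ler_norml; lra.
Qed.

Lemma solution_state (E0 mu : R) (s0 : 'S_N) (t : R) (j : nat) :
  0 < mu ->
  2 * r * T + 4 * r < (1 + eps) / 2 * (mu * ((1 + eps) / 2) ^+ N) ->
  mu + 2 * r <= - eps * tbar ->
  thick_cube tbar r (tau 0 0%N) ->
  spread tbar eps s0 (tau 0 0%N) E0 -> spaced tbar eps s0 (tau 0 0%N) mu 0 ->
  arc_dom tau (t, j) ->
  t <= j.+1%:R * T /\
  dist_to (desync_set tbar eps) (tau t j) <= 2 * N%:R * ((1 + eps) ^+ j * E0) +
    r * (N%:R * (2 * ((2 * T + 4) / - eps) + 4 * T + 1)).
Proof.
move=> mu0 H1 H2 c0 spr0 spa0 domt.
have e1 := eps1; have t0 := tbar0; have r0' := r0; have T0 := T_ge0.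
have [[htd _] _ _ _ _] := sol.
have [tt [tt0 ttj ttS dom]] := hybrid_time_domain_jumps htd domt.
pose F := r * ((2 * T + 4) / - eps).
have F0 : 0 <= F by apply: mulr_ge0 => //; apply: divr_ge0; lra.
have FE : - eps * F = r * (2 * T + 4) by rewrite /F; field; lra.
have state k : (k <= j)%N -> tt k <= k%:R * T /\ exists s : 'S_N,
  [/\ thick_cube tbar r (tau (tt k) k),
      spread tbar eps s (tau (tt k) k) ((1 + eps) ^+ k * E0 + F) &
      spaced tbar eps s (tau (tt k) k) mu 0].
  elim: k => [_|k IH kj].
    rewrite tt0 mul0r; split => //; exists s0; split => // i q.
    by rewrite expr0 mul1r; apply: le_trans (spr0 i q) _; rewrite lerDl.
  have kj' := ltnW kj.
  have [tk [s [ck spr spa]]] := IH kj'.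
  have domk u : tt k <= u <= tt k.+1 -> arc_dom tau (u, k) by exact: dom.
  have dur := flow_duration (ttS k kj') domk ck.
  split; first by rewrite -natr1; lra.
  have [spr' spa'] := flow_state (ttS k kj') domk ck spr spa.
  have ck' := flow_confined (ttS k kj') domk ck (s := tt k.+1).
  have kk : tt k <= tt k.+1 <= tt k.+1 by rewrite lexx ttS.
  have domk1 : arc_dom tau (tt k.+1, k.+1) by apply: dom => //; rewrite lexx ttS.
  have [cn sprn span] := jump_state mu0 H1 H2 (domk _ kk) domk1 (ck' kk) spr' spa'.
  exists (next_rank s); split => // i q; apply: le_trans (sprn i q) _.
  rewrite exprS -[_ * _ * E0]mulrA.
  have rT0 : 0 <= r * T by apply: mulr_ge0.
  apply: noise_absorbed FE _; apply: mulr_ge0 => //; lra.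
have [tj [s [cj spr spa]]] := state j (leqnn j).
have domj u : tt j <= u <= tt j.+1 -> arc_dom tau (u, j) by exact: dom.
have dur := flow_duration (ttS j (leqnn j)) domj cj.
rewrite ttj in dur; split; first by rewrite -natr1; lra.
have [+ _] := flow_state (ttS j (leqnn j)) domj cj spr spa.
have := flow_confined (ttS j (leqnn j)) domj cj (s := tt j.+1).
rewrite lexx ttS // ttj => /(_ isT) ct sprt.
apply: le_trans (dist_le_spread N2 tbar0 eps1 r0 ct sprt) _.
rewrite le_eqVlt /F; apply/orP; left; apply/eqP; ring.
Qed.

End PerturbedSolution.

(** * The comparison function *)

Lemma exponential_class_KL (R : realType) (B a : R) :
  0 < B -> 0 < a -> class_KL (fun r s => B * r * expR (- (a * s))).
Proof.
move=> B0 a0; split.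
- by move=> r s r0 s0; rewrite !mulr_ge0 ?expR_ge0 // ltW.
- by move=> r r' s r0 rr' s0; rewrite ler_wpM2r ?expR_ge0 // ler_pM2l.
- move=> r s s' r0 s0 ss'; apply: ler_wpM2l; first by rewrite mulr_ge0 // ltW.
  by rewrite ler_expR lerN2 ler_pM2l.
- move=> s s0; apply/cvgrPdist_lt => e e0; near=> r.
  have r0 : 0 < r by near: r; exact: nbhs_right_gt.
  rewrite sub0r normrN ger0_norm; last first.
    by rewrite !mulr_ge0 ?expR_ge0 // ltW.
  have : r < e / B by near: r; apply: nbhs_right_lt; exact: divr_gt0.
  rewrite ltr_pdivlMr // mulrC; apply: le_lt_trans.
  rewrite -[leRHS]mulr1; apply: ler_wpM2l; first by rewrite mulr_ge0 // ltW.
  by rewrite -expR0 ler_expR oppr_le0 mulr_ge0 // ltW.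
- move=> r r0; apply/cvgrPdist_lt => e e0; near=> s.
  have s0 : 0 < s by near: s; exact: nbhs_pinfty_gt.
  rewrite sub0r normrN ger0_norm; last by rewrite !mulr_ge0 ?expR_ge0 // ltW.
  rewrite expRN ltr_pdivrMr ?expR_gt0 //.
  have Br0 : 0 <= B * r by rewrite mulr_ge0 // ltW.
  have : B * r / (e * a) < s.
    by near: s; apply: nbhs_pinfty_gt; rewrite num_real.
  rewrite ltr_pdivrMr ?mulr_gt0 // => lt.
  apply: lt_le_trans lt _; have -> : s * (e * a) = e * (a * s) by ring.
  rewrite ler_pM2l //.
  by have := expR_ge1Dx (a * s); lra.
Unshelve. all: by end_near.
Qed.

(** There are at least [(t + j) / (T + 1) - 1] jumps before hybrid time
    [(t, j)]; the factor [l^-1] pays for the [- 1]. *)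
Lemma expn_le_exponential (R : realType) (l T t : R) (j : nat) :
  0 < l < 1 -> 0 <= T -> t <= j.+1%:R * T ->
  l ^+ j <= l^-1 * expR (- (- ln l / (T + 1) * (t + j%:R))).
Proof.
move=> /andP[l0 l1] T0 tT.
have lnl : ln l < 0 by rewrite ln_lt0 // l0.
rewrite ler_pdivlMl // -exprS -{1}(lnK (_ : l \is Num.pos)) ?posrE //.
rewrite -expRM_natl ler_expR.
have : (t + j%:R) / (T + 1) <= j.+1%:R.
  rewrite ler_pdivrMr; last lra.
  have := @natr1 R j; lra.
rewrite -(ler_nM2l lnl); lra.
Qed.

(** * Robust stability *)

Theorem theorem3p6 (R : realType) (N : nat) (tbar omega eps : R)
    (rho : 'rV[R]_N -> R) :
  (2 <= N)%N -> 0 < tbar -> 0 < omega -> -1 < eps < 0 ->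
  (forall x, 0 <= rho x) ->
  continuous rho ->
  (forall x, ~ desync_set tbar eps x -> 0 < rho x) ->
  exists beta : R -> R -> R, class_KL beta /\
    forall K : set 'rV[R]_N, compact K -> K `<=` cube tbar `\` bad_set tbar ->
    forall alpha : R, 0 < alpha ->
    exists delta : R, 0 < delta < 1 /\
      forall tau : hybrid_trajectory R N,
        maximal_solution
          (perturbation (impulsive_oscillators N tbar omega eps)
                        (fun x => delta * rho x)) tau ->
        K (tau 0 0%N) ->
        forall t j, arc_dom tau (t, j) ->
          dist_to (desync_set tbar eps) (tau t j)
            <= beta (dist_to (desync_set tbar eps) (tau 0 0%N)) (t + j%:R)
               + alpha.
Proof.
move=> N2 tbar0 omega0 eps1 rho0 crho _.
set A := desync_set tbar eps.
have l01 : 0 < 1 + eps < 1 by lra.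
have l0 : 0 < 1 + eps by lra.
pose T := 2 * (tbar + 1) / omega.
have T0 : 0 <= T by exact: T_ge0.
pose C := 2 + 4 * tbar / phase_gap N tbar eps.
have C0 : 0 < C.
  have g0 := phase_gap_gt0 N2 tbar0 eps1.
  by rewrite ltr_wpDr //; apply: divr_ge0; lra.
have N0 : 0 < N%:R :> R by rewrite ltr0n; lia.
have B0 : 0 < 2 * N%:R * C by rewrite !mulr_gt0.
have lnl : ln (1 + eps) < 0 by rewrite ln_lt0.
have a0 : 0 < - ln (1 + eps) / (T + 1) by rewrite divr_gt0 ?oppr_gt0 // ltr_wpDl.
exists (fun r s => (2 * N%:R * C / (1 + eps)) * r *
  expR (- (- ln (1 + eps) / (T + 1) * s))).
split; first by apply: exponential_class_KL => //; rewrite divr_gt0.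
move=> K cK Kb alpha alpha0.
have [eta eta0 gapK] := compact_gap cK Kb.
have [M M1 rhoM] := thick_cube_bounded tbar0 crho.
(* A reset creates a gap of at least [- eps * tbar], up to the noise: half of it
   leaves room for the latter. *)
pose mu := Num.min eta (- eps * tbar / 2).
have e0 : 0 < - eps * tbar by rewrite mulr_gt0 ?oppr_gt0 //; lra.
have mu0 : 0 < mu by rewrite lt_min eta0 divr_gt0.
have mu_eta : mu <= eta by rewrite ge_min lexx.
have mu_eps : mu <= - eps * tbar / 2 by rewrite ge_min lexx orbT.
(* [W] is the noise that the gaps tolerate, and [r * Q] the residual distance
   to which the noise leads. *)
pose W := (1 + eps) / 2 * (mu * ((1 + eps) / 2) ^+ N).
have W0 : 0 < W by rewrite !mulr_gt0 ?exprn_gt0 ?divr_gt0.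
pose Q := N%:R * (2 * ((2 * T + 4) / - eps) + 4 * T + 1).
have Q0 : 0 < Q.
  have ? : 0 <= (2 * T + 4) / - eps by apply: divr_ge0; lra.
  by apply: mulr_gt0 => //; lra.
have [r [[r0 r_half r_omega rT r_eps] rQ]] : exists r : R,
    [/\ 0 < r, r <= 1 / 2, r <= omega / 2, 2 * r * T + 4 * r < W &
        r <= - eps * tbar / 4] /\ r * Q <= alpha / 2.
  pose b := Num.min (Num.min (1 / 2) (omega / 2))
    (Num.min (- eps * tbar / 4) (alpha / 2 / Q)).
  pose c := W / 2 / (2 * T + 4).
  have c0 : 0 < c by rewrite /c !divr_gt0 //; lra.
  have b0 : 0 < b by rewrite /b !lt_min !divr_gt0.
  have : [/\ Num.min b c <= b & Num.min b c <= c] by split; rewrite ge_min lexx ?orbT.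
  have r0 : 0 < Num.min b c by rewrite lt_min b0.
  set r := Num.min b c in r0 *; rewrite {1}/b !le_min.
  move=> [/andP[/andP[b1 b2] /andP[b3 b4]] rc].
  exists r; split; last by rewrite -ler_pdivlMr.
  split => //; move: rc; rewrite /c ler_pdivlMr; lra.
have M0 : 0 < M := lt_le_trans ltr01 M1.
have dM : r / M * M = r by rewrite divfK // gt_eqF.
exists (r / M); split.
  by apply/andP; split; [rewrite divr_gt0|rewrite ltr_pdivrMr //; lra].
move=> tau [sol _] Ktau t j domt.
(* Slack for the almost nearest point, so that it costs at most [alpha / 2]. *)
pose k := alpha / 2 / (2 * N%:R * C).
have k0 : 0 < k by rewrite !divr_gt0.
set x0 := tau 0 0%N in Ktau *.
have cx0 : cube tbar x0 by have [] := Kb _ Ktau.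
have gapx (i q : 'I_N) : i != q -> mu <= `|x0 ord0 i - x0 ord0 q| <= tbar - mu.
  by move=> iq; have := gapK _ Ktau i q iq; lra.
have [s spr spa] := initial_ranking N2 tbar0 eps1 k0 mu0 cx0 gapx.
have delta0 : 0 < r / M by rewrite divr_gt0.
have := @solution_state R N tbar omega eps rho (r / M) M tau.
rewrite dM => /(_ N2 tbar0 omega0 eps1 rho0 delta0 M1 rhoM sol r_half r_omega).
have tx0 : thick_cube tbar r x0 by move=> i; have := cx0 i; lra.
have mur : mu + 2 * r <= - eps * tbar by lra.
move=> /(_ _ _ s t j mu0 rT mur tx0 spr spa domt) [tT].
rewrite -/A -/C -/T -/Q => distle; apply: (le_trans distle).
set D := dist_to A x0.
have D0 : 0 <= D by apply: dist_to_ge0; exact: desync_set_nonempty.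
have le1 := expn_le_exponential l01 T0 tT.
have le2 : (1 + eps) ^+ j <= 1 by apply: exprn_ile1; lra.
set X := expR _ in le1 *.
have h1 : 2 * N%:R * C * D * (1 + eps) ^+ j <= 2 * N%:R * C * D * ((1 + eps)^-1 * X).
  by apply: ler_wpM2l => //; rewrite mulr_ge0 // ltW.
have h2 : (1 + eps) ^+ j * (alpha / 2) <= 1 * (alpha / 2).
  by apply: ler_wpM2r => //; rewrite divr_ge0 // ltW.
have -> : 2 * N%:R * ((1 + eps) ^+ j * (C * (D + k))) =
    2 * N%:R * C * D * (1 + eps) ^+ j + (1 + eps) ^+ j * (alpha / 2).
  by rewrite /k; field; rewrite !gt_eqF.
have -> : 2 * N%:R * C / (1 + eps) * D * X =
    2 * N%:R * C * D * ((1 + eps)^-1 * X) by ring.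
lra.
Qed.
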